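(* For all $n\geq 1$, the right-angled Artin group $A(C_n)$ is (isomorphic to) a subgroup of a diagram group.
   Context: $C_n$ denotes a cycle of length $n$ ($n$ vertices); for $n=1,2$ it is to be read as a simplicial graph (a single vertex, respectively a single edge). For a simplicial graph $\Gamma$ with vertex set $V(\Gamma)$ and edge set $E(\Gamma)$, $A(\Gamma)=\langle v\in V(\Gamma)\mid [u,v]=1,\ (u,v)\in E(\Gamma)\rangle$. A semigroup presentation $\mathcal{P}=\langle\Sigma\mid\mathcal{R}\rangle$ consists of an alphabet $\Sigma$ and a set $\mathcal{R}$ of relations $u=v$ with $u,v\in\Sigma^+$, where $\Sigma^+$ is the free semigroup of non-empty words and $\Sigma^*=\Sigma^+\cup\{1\}$ also contains the empty word. Convention: if $u=v\in\mathcal{R}$ then $v=u\notin\mathcal{R}$ (in particular $u=u\notin\mathcal{R}$). The Squier complex $S(\mathcal{P})$ is the cube complex whose vertices are the words over $\Sigma$; whose oriented edges are $(a,u\to v,b)$ with $a,b\in\Sigma^*$ and $u=v$ or $v=u$ in $\mathcal{R}$, going from $aub$ to $avb$ (and $(a,v\to u,b)$ is the same edge with opposite orientation); and whose $n$-cubes are similarly $(a_1,u_1\to v_1,\dots,a_n,u_n\to v_n,a_{n+1})$, spanned by the vertices $a_1w_1\cdots a_nw_na_{n+1}$ with $w_i\in\{u_i,v_i\}$. For $w\in\Sigma^+$, $S(\mathcal{P},w)$ is the connected component containing $w$, and the diagram group $D(\mathcal{P},w)$ is $\pi_1(S(\mathcal{P},w),w)$. A group is a diagram group if it is isomorphic to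 $D(\mathcal{P},w)$ for some semigroup presentation $\mathcal{P}$ and some $w\in\Sigma^+$. *)

(* Defs.v *)
From HB Require Import structures.
From Stdlib Require Import Relation_Operators.
From mathcomp Require Import all_boot.
From mathcomp Require Import boolp classical_sets.

Set Implicit Arguments.
Unset Strict Implicit.
Unset Printing Implicit Defensive.

Local Open Scope quotient_scope.
Local Open Scope group_scope.

(* A group given by representatives: a carrier with operations satisfying the
   group laws up to the equivalence relation [pg_eqv]. *)
Record preGroup := PreGroup {
  pg_sort :> Type;
  pg_mul : pg_sort -> pg_sort -> pg_sort;
  pg_one : pg_sort;
  pg_inv : pg_sort -> pg_sort;
  pg_eqv : pg_sort -> pg_sort -> Prop;
  pg_refl : forall x, pg_eqv x x;
  pg_sym : forall x y, pg_eqv x y -> pg_eqv y x;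
  pg_trans : forall x y z, pg_eqv x y -> pg_eqv y z -> pg_eqv x z;
  pg_mul_eqv : forall x x' y y',
    pg_eqv x x' -> pg_eqv y y' -> pg_eqv (pg_mul x y) (pg_mul x' y');
  pg_mulA : forall x y z,
    pg_eqv (pg_mul x (pg_mul y z)) (pg_mul (pg_mul x y) z);
  pg_mul1 : forall x, pg_eqv (pg_mul pg_one x) x;
  pg_mulr1 : forall x, pg_eqv (pg_mul x pg_one) x;
  pg_mulV : forall x, pg_eqv (pg_mul (pg_inv x) x) pg_one;
  pg_mulrV : forall x, pg_eqv (pg_mul x (pg_inv x)) pg_one }.

Definition pg_choice (G : preGroup) : Type := G.
HB.instance Definition _ (G : preGroup) := gen_eqMixin (pg_choice G).
HB.instance Definition _ (G : preGroup) := gen_choiceMixin (pg_choice G).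

Section QuotientGroup.
Variable G : preGroup.

Definition pg_rel : rel (pg_choice G) := fun x y => `[< pg_eqv (p := G) x y >].

Lemma pg_rel_refl : reflexive pg_rel.
Proof. by move=> x; apply/asboolP; apply: pg_refl. Qed.

Lemma pg_rel_sym : symmetric pg_rel.
Proof. by move=> x y; apply/asboolP/asboolP; apply: pg_sym. Qed.

Lemma pg_rel_trans : transitive pg_rel.
Proof.
by move=> y x z /asboolP xy /asboolP yz; apply/asboolP; apply: pg_trans yz.
Qed.

Canonical pg_equiv := EquivRel pg_rel pg_rel_refl pg_rel_sym pg_rel_trans.

Definition quot_group : Type := {eq_quot pg_equiv}.
HB.instance Definition _ := Choice.on quot_group.

Definition quot_pi (x : G) : quot_group := \pi_({eq_quot pg_equiv}) (x : pg_choice G).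
Definition quot_repr (x : quot_group) : G :=
  repr (x : {eq_quot pg_equiv}).

Lemma quot_piP (x y : G) : quot_pi x = quot_pi y <-> pg_eqv x y.
Proof. by split=> [/eqmodP/asboolP|xy] //; apply/eqmodP/asboolP. Qed.

Lemma quot_reprK (x : quot_group) : quot_pi (quot_repr x) = x.
Proof. exact: reprK. Qed.

Lemma quot_repr_pi (x : G) : pg_eqv (quot_repr (quot_pi x)) x.
Proof. by apply/quot_piP; rewrite quot_reprK. Qed.

Lemma pg_inv_eqv (x y : G) : pg_eqv x y -> pg_eqv (pg_inv x) (pg_inv y).
Proof.
move=> xy; have e := @pg_refl G; have t := @pg_trans G; have s := @pg_sym G.
apply: (t _ _ _ (s _ _ (pg_mulr1 (pg_inv x)))).
apply: (t _ _ _ (pg_mul_eqv (e (pg_inv x)) (s _ _ (pg_mulrV y)))).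
apply: (t _ _ _ (pg_mulA _ _ _)).
apply: (t _ _ _ (pg_mul_eqv (pg_mul_eqv (e _) (s _ _ xy)) (e _))).
apply: (t _ _ _ (pg_mul_eqv (pg_mulV x) (e _))).
exact: pg_mul1.
Qed.

Definition quot_mul (x y : quot_group) : quot_group :=
  quot_pi (pg_mul (quot_repr x) (quot_repr y)).
Definition quot_one : quot_group := quot_pi (pg_one G).
Definition quot_inv (x : quot_group) : quot_group :=
  quot_pi (pg_inv (quot_repr x)).

Lemma quot_mulE (x y : G) :
  quot_mul (quot_pi x) (quot_pi y) = quot_pi (pg_mul x y).
Proof. by apply/quot_piP; apply: pg_mul_eqv; apply: quot_repr_pi. Qed.

Lemma quot_invE (x : G) : quot_inv (quot_pi x) = quot_pi (pg_inv x).
Proof. by apply/quot_piP; apply: pg_inv_eqv; apply: quot_repr_pi. Qed.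

Lemma quot_mulA : associative quot_mul.
Proof.
move=> x y z; rewrite -(quot_reprK x) -(quot_reprK y) -(quot_reprK z).
by rewrite !quot_mulE; apply/quot_piP; apply: pg_mulA.
Qed.

Lemma quot_mul1 : left_id quot_one quot_mul.
Proof.
by move=> x; rewrite -(quot_reprK x) quot_mulE; apply/quot_piP; apply: pg_mul1.
Qed.

Lemma quot_mulr1 : right_id quot_one quot_mul.
Proof.
by move=> x; rewrite -(quot_reprK x) quot_mulE; apply/quot_piP; apply: pg_mulr1.
Qed.

Lemma quot_mulV : left_inverse quot_one quot_inv quot_mul.
Proof.
move=> x; rewrite -(quot_reprK x) quot_invE quot_mulE.
by apply/quot_piP; apply: pg_mulV.
Qed.

Lemma quot_mulrV : right_inverse quot_one quot_inv quot_mul.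
Proof.
move=> x; rewrite -(quot_reprK x) quot_invE quot_mulE.
by apply/quot_piP; apply: pg_mulrV.
Qed.

HB.instance Definition _ := isGroup.Build quot_group
  quot_mulA quot_mul1 quot_mulr1 quot_mulV quot_mulrV.

End QuotientGroup.

Section Presented.
Variables (X : Type) (R : seq (X * bool) -> seq (X * bool) -> Prop).

(* The letter (x, true) stands for the generator x, and (x, false) for its
   formal inverse. *)
Definition gword : Type := seq (X * bool).

Definition gword_inv (p : gword) : gword :=
  rev [seq (l.1, ~~ l.2) | l <- p].

Inductive gword_step : gword -> gword -> Prop :=
| GCancel (s t : gword) x b :
    gword_step (s ++ (x, b) :: (x, ~~ b) :: t) (s ++ t)
| GRelator (s t l r : gword) : R l r ->
    gword_step (s ++ l ++ t) (s ++ r ++ t).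

Definition gword_eqv := clos_refl_sym_trans gword gword_step.

Lemma gword_eqv_cat p p' q q' :
  gword_eqv p p' -> gword_eqv q q' -> gword_eqv (p ++ q) (p' ++ q').
Proof.
have ctx s t u v : gword_eqv u v -> gword_eqv (s ++ u ++ t) (s ++ v ++ t).
  elim=> {u v} [u v uv|u|u v _ uv|u v w _ uv _ vw].
  - apply: rst_step; case: uv => [a b x c|a b l r lr].
      rewrite -!catA !(catA s) /=; exact: GCancel.
    by rewrite -!catA !(catA s); apply: GRelator.
  - exact: rst_refl.
  - exact: rst_sym.
  - exact: rst_trans uv vw.
move=> pp qq; apply: (rst_trans _ _ _ (p' ++ q)).
  exact: (ctx [::] q).
by have := ctx p' [::] _ _ qq; rewrite !cats0.
Qed.

Lemma gword_invK p : gword_inv (gword_inv p) = p.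
Proof.
rewrite /gword_inv map_rev revK -map_comp -[RHS]map_id.
by apply: eq_map => -[x b] /=; rewrite negbK.
Qed.

Lemma gword_mulrV p : gword_eqv (p ++ gword_inv p) [::].
Proof.
elim/last_ind: p => [|p [x b] IHp]; first exact: rst_refl.
apply: rst_trans IHp; rewrite /gword_inv map_rcons rev_rcons cat_rcons /=.
exact/rst_step/GCancel.
Qed.

Lemma gword_mulV p : gword_eqv (gword_inv p ++ p) [::].
Proof. by have := gword_mulrV (gword_inv p); rewrite gword_invK. Qed.

Definition presented_preGroup : preGroup.
Proof.
apply: (@PreGroup gword cat [::] gword_inv gword_eqv).
- exact: rst_refl.
- exact: rst_sym.
- exact: rst_trans.
- exact: gword_eqv_cat.
- by move=> p q r; rewrite catA; apply: rst_refl.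
- by move=> p; apply: rst_refl.
- by move=> p; rewrite cats0; apply: rst_refl.
- exact: gword_mulV.
- exact: gword_mulrV.
Defined.

Definition presented_group : groupType := quot_group presented_preGroup.

End Presented.

Record sgraph := SGraph {
  sg_vertex :> Type;
  sg_adj : sg_vertex -> sg_vertex -> Prop;
  sg_sym : forall u v, sg_adj u v -> sg_adj v u;
  sg_irr : forall u, ~ sg_adj u u }.

Inductive raag_rel (Gam : sgraph) :
    seq (Gam * bool) -> seq (Gam * bool) -> Prop :=
| RaagRel u v : sg_adj u v ->
    raag_rel [:: (u, true); (v, true); (u, false); (v, false)] [::].

Definition raag (Gam : sgraph) : groupType := presented_group (@raag_rel Gam).

(* The condition i != j makes C_1 a single vertex and C_2 a single edge. *)
Definition cycle_adj n (i j : 'I_n) : bool :=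
  (i != j) && ((j == ordS i) || (i == ordS j)).

Lemma cycle_adj_sym n (i j : 'I_n) : cycle_adj i j -> cycle_adj j i.
Proof. by rewrite /cycle_adj eq_sym orbC. Qed.

Lemma cycle_adj_irr n (i : 'I_n) : ~ cycle_adj i i.
Proof. by rewrite /cycle_adj eqxx. Qed.

Definition cycle_graph (n : nat) : sgraph :=
  SGraph (@cycle_adj_sym n) (@cycle_adj_irr n).

(* Each geometric edge carries its two orientations, exchanged by [sc_inv];
   [sc_square e1 e2 f1 f2] says that some square has e1 e2 and f1 f2 as the two
   edge paths joining a pair of opposite corners. *)
Record squareComplex := SquareComplex {
  sc_vertex :> Type;
  sc_edge : Type;
  sc_src : sc_edge -> sc_vertex;
  sc_tgt : sc_edge -> sc_vertex;
  sc_inv : sc_edge -> sc_edge;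
  sc_square : sc_edge -> sc_edge -> sc_edge -> sc_edge -> Prop;
  sc_invK : involutive sc_inv;
  sc_src_inv : forall e, sc_src (sc_inv e) = sc_tgt e;
  sc_squareP : forall e1 e2 f1 f2, sc_square e1 e2 f1 f2 ->
    [/\ sc_src e1 = sc_src f1, sc_tgt e1 = sc_src e2,
        sc_tgt f1 = sc_src f2 & sc_tgt e2 = sc_tgt f2] }.

(* The fundamental group of a square complex is its edge-path group: loops in
   the 1-skeleton up to homotopies that remove or insert backtracks and cross
   squares. *)
Section Pi1.
Variable X : squareComplex.

Fixpoint is_edge_path (x : X) (p : seq (sc_edge X)) (y : X) : Prop :=
  if p is e :: p' then sc_src e = x /\ is_edge_path (sc_tgt e) p' y else x = y.

Lemma is_edge_path_cat x p y q z :
  is_edge_path x p y -> is_edge_path y q z -> is_edge_path x (p ++ q) z.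
Proof. by elim: p x => [|e p IHp] x /= => [->|[-> /IHp h] /h]. Qed.

Definition path_inv (p : seq (sc_edge X)) : seq (sc_edge X) :=
  rev (map (@sc_inv X) p).

Lemma sc_tgt_inv (e : sc_edge X) : sc_tgt (sc_inv e) = sc_src e.
Proof. by rewrite -{2}(sc_invK e) sc_src_inv. Qed.

Lemma is_edge_path_inv x p y :
  is_edge_path x p y -> is_edge_path y (path_inv p) x.
Proof.
elim: p x => [|e p IHp] x /= => [->//|[<- /IHp h]].
rewrite /path_inv /= rev_cons -cats1; apply: is_edge_path_cat h _ => /=.
by rewrite sc_src_inv sc_tgt_inv.
Qed.

Lemma path_invK p : path_inv (path_inv p) = p.
Proof.
rewrite /path_inv map_rev revK -map_comp -[RHS]map_id.
by apply: eq_map => e /=; rewrite sc_invK.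
Qed.

Variable x : X.

Record loop := Loop {
  loop_path :> seq (sc_edge X);
  loopP : is_edge_path x loop_path x }.

Definition loop_cat (p q : loop) : loop :=
  Loop (is_edge_path_cat (loopP p) (loopP q)).
Definition loop_nil : loop := @Loop [::] erefl.
Definition loop_inv (p : loop) : loop := Loop (is_edge_path_inv (loopP p)).

Inductive path_step : seq (sc_edge X) -> seq (sc_edge X) -> Prop :=
| PBacktrack s t e : path_step (s ++ e :: sc_inv e :: t) (s ++ t)
| PSquare s t e1 e2 f1 f2 : sc_square e1 e2 f1 f2 ->
    path_step (s ++ e1 :: e2 :: t) (s ++ f1 :: f2 :: t).

Definition loop_step (p q : loop) : Prop := path_step p q.

Definition homotopic := clos_refl_sym_trans loop loop_step.

Lemma loop_eq (p q : loop) : p = q :> seq _ -> p = q.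
Proof.
case: p q => [p hp] [q hq] /= pq; rewrite -{q}pq in hq *.
by congr Loop; apply: Prop_irrelevance.
Qed.

Lemma homotopic_cat p p' q q' :
  homotopic p p' -> homotopic q q' ->
  homotopic (loop_cat p q) (loop_cat p' q').
Proof.
move=> pp qq; apply: (rst_trans _ _ _ (loop_cat p' q)).
  elim: pp => {p p'} [p p' pp|p|p p' _ h|p r p' _ h1 _ h2].
  - apply: rst_step; rewrite /loop_step /=.
    by case: pp => *; rewrite -!catA /=; constructor.
  - exact: rst_refl.
  - exact: rst_sym.
  - exact: rst_trans h1 h2.
elim: qq => {q q'} [q q' qq|q|q q' _ h|q r q' _ h1 _ h2].
- apply: rst_step; rewrite /loop_step /=.
  by case: qq => *; rewrite !(catA (loop_path p')) /=; constructor.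
- exact: rst_refl.
- exact: rst_sym.
- exact: rst_trans h1 h2.
Qed.

Lemma homotopic_eq (p q : loop) : p = q :> seq _ -> homotopic p q.
Proof. by move/loop_eq->; apply: rst_refl. Qed.

Lemma path_inv_contract y p (hp : is_edge_path x p y)
    (h : is_edge_path x (p ++ path_inv p) x) : homotopic (Loop h) loop_nil.
Proof.
elim/last_ind: p y hp h => [|p e IHp] y hp h; first exact: homotopic_eq.
have hp' : is_edge_path x p (sc_src e).
  by elim: p x hp {IHp h} => [|f p IHp] z /= [-> // /IHp].
have h' := is_edge_path_cat hp' (is_edge_path_inv hp').
apply: (rst_trans _ _ _ (Loop h')); last exact: IHp hp' h'.
apply: rst_step; rewrite /loop_step /= /path_inv map_rcons rev_rcons cat_rcons.
exact: PBacktrack.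
Qed.

Lemma loop_mulrV p : homotopic (loop_cat p (loop_inv p)) loop_nil.
Proof. exact: path_inv_contract (loopP p) _. Qed.

Lemma loop_mulV p : homotopic (loop_cat (loop_inv p) p) loop_nil.
Proof.
apply: rst_trans (loop_mulrV (loop_inv p)).
by apply: homotopic_eq; rewrite /= path_invK.
Qed.

Definition pi1_preGroup : preGroup.
Proof.
apply: (@PreGroup loop loop_cat loop_nil loop_inv homotopic).
- exact: rst_refl.
- exact: rst_sym.
- exact: rst_trans.
- exact: homotopic_cat.
- by move=> p q r; apply: homotopic_eq; rewrite /= catA.
- by move=> p; apply: homotopic_eq.
- by move=> p; apply: homotopic_eq; rewrite /= cats0.
- exact: loop_mulV.
- exact: loop_mulrV.
Defined.

Definition pi1 : groupType := quot_group pi1_preGroup.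

End Pi1.

Record semigroupPresentation := SemigroupPresentation {
  sp_alphabet : Type;
  sp_rel : set (seq sp_alphabet * seq sp_alphabet);
  sp_rel_nonempty : forall u v, sp_rel (u, v) -> u <> [::] /\ v <> [::];
  sp_rel_asym : forall u v, sp_rel (u, v) -> ~ sp_rel (v, u) }.

Section Squier.
Variable P : semigroupPresentation.
Local Notation word := (seq (sp_alphabet P)).

Record rewriting := Rewriting {
  rw_lhs : word;
  rw_rhs : word;
  rwP : sp_rel (rw_lhs, rw_rhs) \/ sp_rel (rw_rhs, rw_lhs) }.

Definition rw_inv (r : rewriting) : rewriting :=
  Rewriting (iffLR (or_comm _ _) (rwP r)).

Lemma rw_invK : involutive rw_inv.
Proof.
by case=> u v h; rewrite /rw_inv /=; congr Rewriting; apply: Prop_irrelevance.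
Qed.

(* The oriented edge (a, u -> v, b), from a u b to a v b. *)
Record squier_edge := SquierEdge {
  se_left : word;
  se_rw : rewriting;
  se_right : word }.

Definition squier_src (e : squier_edge) : word :=
  se_left e ++ rw_lhs (se_rw e) ++ se_right e.
Definition squier_tgt (e : squier_edge) : word :=
  se_left e ++ rw_rhs (se_rw e) ++ se_right e.
Definition squier_inv (e : squier_edge) : squier_edge :=
  SquierEdge (se_left e) (rw_inv (se_rw e)) (se_right e).

(* The square (a, u1 -> v1, b, u2 -> v2, c), from its corner a u1 b u2 c to the
   opposite corner a v1 b v2 c. Reversing u1 -> v1 or u2 -> v2 gives the same
   square seen from another corner. *)
Inductive squier_square :
  squier_edge -> squier_edge -> squier_edge -> squier_edge -> Prop :=
| SquierSquare (a : word) (r1 : rewriting) (b : word) (r2 : rewriting)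
    (c : word) :
    squier_square
      (SquierEdge a r1 (b ++ rw_lhs r2 ++ c))
      (SquierEdge (a ++ rw_rhs r1 ++ b) r2 c)
      (SquierEdge (a ++ rw_lhs r1 ++ b) r2 c)
      (SquierEdge a r1 (b ++ rw_rhs r2 ++ c)).

Lemma squier_invK : involutive squier_inv.
Proof. by case=> a r b; rewrite /squier_inv /= rw_invK. Qed.

Lemma squier_src_inv e : squier_src (squier_inv e) = squier_tgt e.
Proof. by []. Qed.

Lemma squier_squareP e1 e2 f1 f2 : squier_square e1 e2 f1 f2 ->
  [/\ squier_src e1 = squier_src f1, squier_tgt e1 = squier_src e2,
      squier_tgt f1 = squier_src f2 & squier_tgt e2 = squier_tgt f2].
Proof. by case=> *; rewrite /squier_src /squier_tgt /= -!catA. Qed.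

(* The 2-skeleton of the Squier complex S(P): its cubes of dimension at least 3
   have no effect on fundamental groups. *)
Definition squier : squareComplex :=
  SquareComplex squier_invK squier_src_inv squier_squareP.

(* Loops based at w stay in the connected component S(P, w). *)
Definition diagram_group (w : word) : groupType := @pi1 squier w.

End Squier.

Definition isomorphic (G H : groupType) : Prop :=
  exists f : {multiplicative G -> H}, bijective f.

Definition is_diagram_group (G : groupType) : Prop :=
  exists (P : semigroupPresentation) (w : seq (sp_alphabet P)),
    w <> [::] /\ isomorphic G (diagram_group w).

(* An injective morphism identifies H with its image, a subgroup of G. *)
Definition embeds (H G : groupType) : Prop :=
  exists f : {multiplicative H -> G}, injective f.

(* Main.v *)
(* The right-angled Artin group of the complement of a path on N vertices embeds
   in a diagram group: over the word x_0 x_1 ... x_N, let the i-th generator be a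
   triangle of rewritings of the subword x_i x_(i+1); triangles at disjoint
   subwords commute, and labelling edges of the Squier complex gives a retraction.

   Write A(G) for the right-angled Artin group of G. The complement of C_5 is a
   pentagon, around which the path on nine vertices winds almost twice; sending each
   generator of A(C_5) to the product of its preimages embeds A(C_5) in the group
   of the complement of that path. To prove injectivity, view A(C_5) as an HNN
   extension with stable letter the middle vertex 0, compare it with the HNN
   extension whose base is a product of two copies of the base (one for each half
   of the path), and apply Britton's lemma.

   For n > 5, the kernel of the map A(G) -> Z/2 killing all generators but v
   contains the Artin group of two copies of G glued along the star of v.
   Iterating this from C_5 yields theta graphs with two paths of lengths 2 and 3
   and a third of any length m > 2, hence C_(m+2). For n < 5, C_n is an
   induced subgraph of the complement of the path on nine vertices. *)
From HB Require Import structures.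
From Stdlib Require Import Relation_Operators.
Require Import Defs.
From mathcomp Require Import all_boot.
From mathcomp Require Import boolp.
From mathcomp Require Import zify.

Set Implicit Arguments.
Unset Strict Implicit.
Unset Printing Implicit Defensive.

(** * Presented groups and groups of bijections *)

Definition gen (X : Type) (R : seq (X * bool) -> seq (X * bool) -> Prop)
    (x : X) : presented_group R :=
  quot_pi (G := presented_preGroup R) [:: (x, true)].

Notation vgen := (gen (@raag_rel _)).

Section Groups.
Local Open Scope group_scope.

Lemma homM (G H : groupType) (F : {multiplicative G -> H}) x y :
  F (x * y) = F x * F y.
Proof. exact: gmulfM. Qed.

Lemma hom1 (G H : groupType) (F : {multiplicative G -> H}) : F 1 = 1.
Proof. by apply: (mulgI (F 1)); rewrite -homM !mulg1. Qed.

Lemma homV (G H : groupType) (F : {multiplicative G -> H}) x :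
  F x^-1 = (F x)^-1.
Proof. by apply: (mulgI (F x)); rewrite -homM !mulgV hom1. Qed.

Lemma hom_inj (G H : groupType) (F : {multiplicative G -> H}) :
  (forall x, F x = 1 -> x = 1) -> injective F.
Proof.
move=> Fker x y Fxy; apply: (mulIg y^-1); rewrite mulgV; apply: Fker.
by rewrite homM homV Fxy mulgV.
Qed.

Lemma quot_piM (G : preGroup) (x y : G) :
  quot_pi (pg_mul x y) = quot_pi x * quot_pi y.
Proof. by rewrite [_ * _]quot_mulE. Qed.

Lemma quot_piV (G : preGroup) (x : G) : quot_pi (pg_inv x) = (quot_pi x)^-1.
Proof. by rewrite [_^-1]quot_invE. Qed.

Lemma quot_lift (G : preGroup) (H : groupType) (f : G -> H) :
    (forall x y : G, pg_eqv x y -> f x = f y) ->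
    (forall x y : G, f (pg_mul x y) = f x * f y) ->
  exists F : {multiplicative quot_group G -> H},
    forall x, F (quot_pi x) = f x.
Proof.
move=> f_eqv fM; pose F (x : quot_group G) := f (quot_repr x).
have FE x : F (quot_pi x) = f x by apply/f_eqv/quot_repr_pi.
have FM : {morph F : x y / x * y}.
  by move=> x y; rewrite -fM -FE /F; congr (f (quot_repr _)).
pose mF := isMultiplicative.Build (quot_group G) H F FM.
by exists (HB.pack_for {multiplicative quot_group G -> H} F mF).
Qed.

Section Presented.
Variables (X : Type) (R : seq (X * bool) -> seq (X * bool) -> Prop).
Local Notation gen := (@gen X R).

Lemma presented_ind (P : presented_group R -> Prop) :
    P 1 -> (forall x g, P g -> P (gen x * g)) ->
    (forall x g, P g -> P ((gen x)^-1 * g)) ->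
  forall g, P g.
Proof.
move=> P1 Pg PV g; rewrite -(quot_reprK g); move: (quot_repr g) => {g}.
elim=> [//|[x [] p IHp]]; first by move: (Pg x _ IHp); rewrite [_ * _]quot_mulE.
by move: (PV x _ IHp); rewrite [_ ^-1]quot_invE [_ * _]quot_mulE.
Qed.

Lemma presented_hom_ext (G : groupType)
    (F F' : {multiplicative presented_group R -> G}) :
  (forall x, F (gen x) = F' (gen x)) -> F =1 F'.
Proof.
move=> FF'; elim/presented_ind => [|x g IHg|x g IHg]; first by rewrite !hom1.
  by rewrite !homM IHg FF'.
by rewrite !homM !homV IHg FF'.
Qed.

Variables (G : groupType) (f : X -> G).

Definition word_eval (p : gword X) : G :=
  \prod_(l <- p) (if l.2 then f l.1 else (f l.1)^-1).

Lemma presented_lift :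
    (forall l r, R l r -> word_eval l = word_eval r) ->
  exists F : {multiplicative presented_group R -> G}, forall x, F (gen x) = f x.
Proof.
move=> fR; pose E : presented_preGroup R -> G := word_eval.
have [||F FE] := @quot_lift (presented_preGroup R) G E.
- move=> p q; elim=> {p q} [p q|//|p q _ //|p q r _ -> _ //].
  case=> [s t x b|s t l r /fR lr]; rewrite /E /word_eval !big_cat /=.
    by rewrite !big_cons /=; case: b => /=; rewrite ?mulKg ?mulVKg.
  by congr (_ * (_ * _)).
- by move=> p q; rewrite /E /word_eval big_cat.
by exists F => x; rewrite FE /E /word_eval big_seq1.
Qed.

End Presented.

Lemma raag_gen_commute (Gam : sgraph) (u v : Gam) :
  sg_adj u v -> commute (vgen u) (vgen v).
Proof.
move=> uv; set x := gen _ u; set y := gen _ v.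
have xy : x * (y * (x^-1 * y^-1)) = 1.
  pose G := presented_preGroup (@raag_rel Gam).
  have: quot_pi (G := G) (pg_mul (p := G) [:: (u, true)]
      (pg_mul (p := G) [:: (v, true)]
        (pg_mul (pg_inv (p := G) [:: (u, true)])
          (pg_inv (p := G) [:: (v, true)])))) = quot_pi (pg_one G).
    by apply/quot_piP/rst_step/(GRelator [::] [::] (RaagRel uv)).
  by rewrite !quot_piM !quot_piV.
by apply: (mulIg (x^-1 * y^-1)); rewrite -!mulgA xy mulVKg mulgV.
Qed.

Lemma raag_lift (Gam : sgraph) (G : groupType) (f : Gam -> G) :
    (forall u v, sg_adj u v -> commute (f u) (f v)) ->
  exists F : {multiplicative raag Gam -> G},
    forall u, F (vgen u) = f u.
Proof.
move=> fC; apply: presented_lift => _ _ [u v /fC uv].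
rewrite /word_eval !big_cons big_nil /= mulg1.
by rewrite mulgA uv -mulgA [f u * _]mulgA mulgV mul1g mulgV.
Qed.

Lemma embeds_trans (G H K : groupType) : embeds G H -> embeds H K -> embeds G K.
Proof.
move=> [f f_inj] [g g_inj].
exists (g \o f : {multiplicative G -> K}); exact: inj_comp.
Qed.

End Groups.

Section Symmetric.
Local Open Scope group_scope.
Variable X : Type.

Record self_bij := SelfBij {
  sym_fun :> X -> X;
  sym_ifun : X -> X;
  sym_funK : cancel sym_fun sym_ifun;
  sym_ifunK : cancel sym_ifun sym_fun }.

HB.instance Definition _ := gen_eqMixin self_bij.
HB.instance Definition _ := gen_choiceMixin self_bij.

Lemma sym_eqP (f g : self_bij) : f =1 g -> f = g.
Proof.
case: f g => [f f' fK f'K] [g g' gK g'K] /= /funext fg; subst g.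
have f'g' : f' = g' by apply: funext => x; rewrite -{1}(g'K x) fK.
by subst g'; congr SelfBij; apply: Prop_irrelevance.
Qed.

Definition sym_mul (f g : self_bij) : self_bij :=
  SelfBij (can_comp (sym_funK f) (sym_funK g))
            (can_comp (sym_ifunK g) (sym_ifunK f)).
Definition sym_one : self_bij :=
  @SelfBij id id (fun=> erefl) (fun=> erefl).
Definition sym_inv (f : self_bij) : self_bij :=
  SelfBij (sym_ifunK f) (sym_funK f).

Lemma sym_mulA : associative sym_mul.
Proof. by move=> f g h; apply: sym_eqP. Qed.
Lemma sym_mul1 : left_id sym_one sym_mul.
Proof. by move=> f; apply: sym_eqP. Qed.
Lemma sym_mulr1 : right_id sym_one sym_mul.
Proof. by move=> f; apply: sym_eqP. Qed.
Lemma sym_mulV : left_inverse sym_one sym_inv sym_mul.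
Proof. by move=> f; apply: sym_eqP => x; apply: sym_funK. Qed.
Lemma sym_mulrV : right_inverse sym_one sym_inv sym_mul.
Proof. by move=> f; apply: sym_eqP => x; apply: sym_ifunK. Qed.

HB.instance Definition _ := isGroup.Build self_bij
  sym_mulA sym_mul1 sym_mulr1 sym_mulV sym_mulrV.

Lemma sym_mulE (f g : self_bij) x : (f * g) x = f (g x).
Proof. by []. Qed.

Lemma sym_funVK (f : self_bij) x : f^-1 (f x) = x.
Proof. exact: sym_funK. Qed.

End Symmetric.

(** * Doubling a graph along a star *)

Section Doubling.
Local Open Scope group_scope.
Variables (Gam Gam' : sgraph) (v : Gam).
Variables (pi : Gam' -> Gam) (side : Gam' -> bool).

Definition star (x : Gam) : Prop := x = v \/ sg_adj v x.

(** Together the two hypotheses present [Gam'] as an induced subgraph of two copies of [Gam] glued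
    along the star of [v]; the [side] of a star vertex is arbitrary. *)
Hypothesis pi_adj : forall u u', sg_adj u u' <->
  sg_adj (pi u) (pi u') /\
  (side u = side u' \/ star (pi u) \/ star (pi u')).
Hypothesis pi_inj : forall u u', pi u = pi u' ->
  side u = side u' \/ star (pi u) -> u = u'.

(** The value 1 stands for a vertex of the double that [Gam'] omits; a star vertex counts as lying
    on both sides. *)
Definition dbl_lift (i : bool) (x : Gam) : raag Gam' :=
  if pselect (exists u, pi u = x /\ (side u = i \/ star x)) is left ex
  then vgen (projT1 (cid ex)) else 1.

Lemma dbl_liftE u i : side u = i \/ star (pi u) ->
  dbl_lift i (pi u) = vgen u.
Proof.
move=> ui; rewrite /dbl_lift; case: pselect => [ex|[]]; last by exists u.
case: (cid ex) => u' /= [uu' side_u']; congr (gen _ _).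
apply: pi_inj => //; rewrite uu'.
by case: ui side_u' => [->|]; [case|]; auto.
Qed.

Lemma dbl_lift_star i j x : star x -> dbl_lift i x = dbl_lift j x.
Proof.
move=> sx; rewrite {1}/dbl_lift; case: pselect => [ex|nex].
  case: (cid ex) => u /= [ux _]; rewrite -ux in sx *.
  by rewrite dbl_liftE //; right.
rewrite /dbl_lift; case: pselect => // ex; case: nex.
by case: ex => u [ux _]; exists u; split=> //; right.
Qed.

Lemma dbl_lift_commute i x y :
  sg_adj x y -> commute (dbl_lift i x) (dbl_lift i y).
Proof.
move=> xy; rewrite {1}/dbl_lift; case: pselect => [ex|_];
  last exact/commute_sym/commute1.
case: (cid ex) => u /= [ux side_u]; rewrite /dbl_lift.
case: pselect => [ey|_]; last exact: commute1.
case: (cid ey) => u' /= [uy side_u']; apply/raag_gen_commute/pi_adj.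
rewrite ux uy; split=> //; case: side_u => [->|]; last by right; left.
by case: side_u' => [->|]; [left|right; right].
Qed.

Local Notation X := (raag Gam' * bool)%type.

(* If Gam' is the full double, A(Gam') is a subgroup of index 2, in which the copy
   of v stands for the square of v, and this is the action of A(Gam) induced from
   left multiplication; vertices of the double missing from Gam' act trivially. *)
Definition dbl_fun (x : Gam) (p : X) : X :=
  if pselect (x = v) is left _ then
    (if p.2 then dbl_lift true v * p.1 else p.1, ~~ p.2)
  else (dbl_lift p.2 x * p.1, p.2).

Definition dbl_ifun (x : Gam) (p : X) : X :=
  if pselect (x = v) is left _ then
    (if p.2 then p.1 else (dbl_lift true v)^-1 * p.1, ~~ p.2)
  else ((dbl_lift p.2 x)^-1 * p.1, p.2).

Lemma dbl_funK x : cancel (dbl_fun x) (dbl_ifun x).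
Proof.
rewrite /dbl_fun /dbl_ifun => -[h i]; case: pselect => _ /=;
  last by rewrite mulKg.
by case: i => //=; rewrite mulKg.
Qed.

Lemma dbl_ifunK x : cancel (dbl_ifun x) (dbl_fun x).
Proof.
rewrite /dbl_fun /dbl_ifun => -[h i]; case: pselect => _ /=;
  last by rewrite mulVKg.
by case: i => //=; rewrite mulVKg.
Qed.

Definition dbl_sym x : self_bij X := SelfBij (dbl_funK x) (dbl_ifunK x).

Lemma dbl_sym_commute x y : sg_adj x y -> commute (dbl_sym x) (dbl_sym y).
Proof.
have vC z : sg_adj v z -> commute (dbl_sym v) (dbl_sym z).
  move=> vz; apply: sym_eqP => -[h i]; rewrite !sym_mulE /= /dbl_fun.
  case: pselect => // _; case: pselect => [zv|_] /=.
    by case: (@sg_irr Gam v); rewrite -{2}zv.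
  rewrite (@dbl_lift_star (~~ i) i); last by right.
  by case: i => //=; congr pair; rewrite !mulgA; congr (_ * _);
    apply: dbl_lift_commute.
move=> xy; have [xv|nxv] := pselect (x = v).
  by rewrite xv; apply: vC; rewrite -xv.
have [yv|nyv] := pselect (y = v).
  by apply: commute_sym; rewrite yv; apply: vC; rewrite -yv; apply: sg_sym.
apply: sym_eqP => -[h i]; rewrite !sym_mulE /= /dbl_fun.
do 2?[case: pselect => // _] => /=; congr pair; rewrite !mulgA; congr (_ * _).
exact: dbl_lift_commute.
Qed.

(** Schreier generators, for the transversal formed by 1 and the inverse of [v], of the kernel of
    the map to Z/2 that kills all generators but [v]. *)
Definition dbl_elt (i : bool) (x : Gam) : raag Gam :=
  if pselect (x = v) is left _ then vgen v * vgen v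
  else if i then (vgen v)^-1 * vgen x * vgen v else vgen x.

Lemma dbl_elt_star i j x : star x -> dbl_elt i x = dbl_elt j x.
Proof.
rewrite /dbl_elt => -[->|vx]; case: pselect => // _.
have E : (vgen v)^-1 * vgen x * vgen v = vgen x.
  by rewrite -mulgA -(raag_gen_commute vx) mulKg.
by rewrite E; case: i; case: j.
Qed.

Lemma dbl_elt_commute i x y : sg_adj x y -> commute (dbl_elt i x) (dbl_elt i y).
Proof.
have vC z j : sg_adj v z -> commute (dbl_elt j v) (dbl_elt j z).
  move=> vz; rewrite (@dbl_elt_star j false v) ?(@dbl_elt_star j false z);
    try by [left | right].
  rewrite /dbl_elt; case: pselect => // _; case: pselect => _ //=.
  by apply/commute_sym/commuteM; apply/commute_sym/raag_gen_commute.
move=> xy; have [xv|nxv] := pselect (x = v).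
  by rewrite xv; apply: vC; rewrite -xv.
have [yv|nyv] := pselect (y = v).
  by apply: commute_sym; rewrite yv; apply: vC; rewrite -yv; apply: sg_sym.
rewrite /dbl_elt; do 2?[case: pselect => // _].
have := raag_gen_commute xy; case: i => // xyC.
rewrite /commute -!mulgA; congr (_ * _).
by rewrite ![vgen v * (_ * _)]mulVKg !mulgA xyC.
Qed.

(** On the sheet [false], [Phi g] acts as left multiplication by [g], so [g] can be read off from
    the image of [(1, false)]. *)
Lemma raag_double : embeds (raag Gam') (raag Gam).
Proof.
have [Theta ThetaE] := raag_lift dbl_sym_commute.
have [|Phi PhiE] :=
    @raag_lift Gam' (raag Gam) (fun u => dbl_elt (side u) (pi u)).
  move=> u u' /pi_adj[/dbl_elt_commute pC]; case=> [<-//|[su|su]].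
    by rewrite (dbl_elt_star (side u) (side u') su).
  by rewrite (dbl_elt_star (side u') (side u) su).
have act_gen u h :
    Theta (Phi (vgen u)) (h, false) = (vgen u * h, false).
  rewrite PhiE /dbl_elt.
  have [uv|nuv] := pselect (pi u = v).
    case: pselect => // _; rewrite (homM Theta) ThetaE !sym_mulE /= /dbl_fun.
    case: pselect => //= _.
    by rewrite -uv dbl_liftE //; right; left.
  case: pselect => // _; case ui: (side u).
    rewrite !(homM Theta) (homV Theta) !ThetaE !sym_mulE.
    rewrite [dbl_sym v _]/= /dbl_fun.
    case: pselect => //= _.
    rewrite /dbl_fun; case: pselect => //= _; rewrite dbl_liftE; last by left.
    by rewrite /dbl_ifun; case: pselect.
  rewrite ThetaE /= /dbl_fun; case: pselect => //= _.
  by rewrite dbl_liftE //; left.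
have act g h : Theta (Phi g) (h, false) = (g * h, false).
  elim/presented_ind: g h => [|u g IHg|u g IHg] h.
  - by rewrite (hom1 Phi) (hom1 Theta) mul1g.
  - by rewrite (homM Phi) (homM Theta) sym_mulE IHg act_gen mulgA.
  - rewrite (homM Phi) (homM Theta) sym_mulE IHg !homV.
    by rewrite -{1}[g * h](mulVKg (vgen u)) -act_gen sym_funVK mulgA.
exists Phi; apply: hom_inj => g Phig1.
by have := act g 1; rewrite Phig1 (hom1 Theta) mulg1 => -[].
Qed.

End Doubling.

(** * HNN extensions along a retract *)

Section SplitHNN.
Local Open Scope group_scope.
Variables (B : groupType) (rho : {multiplicative B -> B}).
Hypothesis rhoK : forall b, rho (rho b) = rho b.

(** This element of the kernel of [rho] represents the right coset of [b] modulo the image of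
    [rho]. *)
Definition ker_part (b : B) : B := (rho b)^-1 * b.

Lemma mul_ker_part b : rho b * ker_part b = b.
Proof. by rewrite mulVKg. Qed.

Lemma rho_ker_part b : rho (ker_part b) = 1.
Proof. by rewrite homM homV rhoK mulVg. Qed.

Lemma ker_part_rhoM b k : rho k = 1 -> ker_part (rho b * k) = k.
Proof. by move=> k1; rewrite /ker_part homM rhoK k1 mulg1 mulKg. Qed.

Lemma ker_partM c b : rho c = c -> ker_part (c * b) = ker_part b.
Proof. by move=> cC; rewrite /ker_part homM cC invgM -mulgA mulKg. Qed.

(** A pair [(b, [:: (e1, k1); (e2, k2); ...])] encodes the normal form b t^e1 k1 t^e2 k2 ..., where
    the stable letter t commutes with the image of [rho] and [e] gives the sign of the exponent. *)
Fixpoint hnn_reduced (s : seq (bool * B)) : bool :=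
  if s is (e, k) :: s' then
    [&& rho k == 1, hnn_reduced s' &
        ~~ ((k == 1) && (if s' is (e', _) :: _ then e' != e else false))]
  else true.

(** Left multiplication by t^e: the factor [rho p.1] moves to the left of the new letter, unless
    that letter meets its inverse and cancels. *)
Definition hnn_step (e : bool) (p : B * seq (bool * B)) : B * seq (bool * B) :=
  if p.2 is (e', k) :: s then
    if (ker_part p.1 == 1) && (e' != e) then (p.1 * k, s)
    else (rho p.1, (e, ker_part p.1) :: p.2)
  else (rho p.1, [:: (e, ker_part p.1)]).

Lemma hnn_step_reduced e p : hnn_reduced p.2 -> hnn_reduced (hnn_step e p).2.
Proof.
case: p => b [|[e' k] s] /=; rewrite /hnn_step /=.
  by rewrite rho_ker_part eqxx andbF.
by case: ifP => /= [_ /and3P[]//|->] ->; rewrite rho_ker_part eqxx.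
Qed.

(** A newly created letter is cancelled by the opposite step. After a cancellation, reducedness
    prevents a second one, so the opposite step restores the lost letter. *)
Lemma hnn_stepK e p :
  hnn_reduced p.2 -> hnn_step (~~ e) (hnn_step e p) = p.
Proof.
have back b s : hnn_step (~~ e) (rho b, (e, ker_part b) :: s) = (b, s).
  rewrite /hnn_step /= -{1}[rho b]mulg1 ker_part_rhoM ?hom1 // eqxx.
  by rewrite mul_ker_part; case: e.
case: p => b [|[e' k] s] /= red_s; first exact: back.
rewrite {2}/hnn_step /=; case: ifP => [/andP[/eqP b1 e'e]|_]; last exact: back.
have bC : rho b = b by rewrite -{2}(mul_ker_part b) b1 mulg1.
case/and3P: red_s => /eqP k1 red_s; rewrite -bC /hnn_step /= ker_part_rhoM //.
have -> : e' = ~~ e by case: e e' e'e {back} => [] [].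
case: s {red_s} => [_|[e'' k''] s nred].
  by rewrite homM rhoK k1 mulg1.
by rewrite (negbTE nred) homM rhoK k1 mulg1.
Qed.

Definition hnn_word : Type :=
  {p : B * seq (bool * B) | hnn_reduced p.2}.

Definition stable_fun e (x : hnn_word) : hnn_word :=
  Sub (hnn_step e (val x)) (hnn_step_reduced e (valP x)).

Lemma stable_funK e : cancel (stable_fun e) (stable_fun (~~ e)).
Proof. by move=> x; apply: val_inj => /=; apply/hnn_stepK/(valP x). Qed.

Definition stable : self_bij hnn_word :=
  SelfBij (stable_funK true) (stable_funK false).

Definition base_fun b (x : hnn_word) : hnn_word :=
  exist (fun p => hnn_reduced p.2) (b * (val x).1, (val x).2) (valP x).

Lemma base_funK b : cancel (base_fun b) (base_fun b^-1).
Proof.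
move=> x; apply: val_inj => /=. rewrite mulKg. by case: x => -[].
Qed.

Lemma base_funVK b : cancel (base_fun b^-1) (base_fun b).
Proof.
by move=> x; apply: val_inj => /=; rewrite mulVKg; case: x => -[].
Qed.

Definition base_sym b : self_bij hnn_word :=
  SelfBij (base_funK b) (base_funVK b).

Lemma base_symM : {morph base_sym : b c / b * c}.
Proof.
move=> b c; apply: sym_eqP => x; apply: val_inj.
by rewrite sym_mulE /= mulgA.
Qed.

HB.instance Definition _ :=
  isMultiplicative.Build B (self_bij hnn_word) base_sym base_symM.

Lemma stable_base_commute b : rho b = b -> commute stable (base_sym b).
Proof.
move=> bC; apply: sym_eqP => x; apply: val_inj; rewrite !sym_mulE /=.
case: x => -[c s] red_s /=; rewrite /hnn_step /= ker_partM // homM bC.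
by case: s {red_s} => [|[e k] s] //=; case: ifP => //=; rewrite mulgA.
Qed.

Definition hnn_empty (b : B) : hnn_word :=
  exist (fun p => hnn_reduced p.2) (b, [::]) isT.

(** Such an element is t^e times a word: its base part lies in the image of [rho], hence moves past
    the first letter. *)
Definition hnn_starts (e : bool) (x : hnn_word) : Prop :=
  exists k s, (val x).2 = (e, k) :: s /\ rho (val x).1 = (val x).1.

Definition stable_pow (e : bool) : self_bij hnn_word :=
  if e then stable else stable^-1.

Lemma stable_powE e x : stable_pow e x = stable_fun e x.
Proof. by case: e. Qed.

Lemma hnn_starts_empty e b : hnn_starts e (stable_pow e (hnn_empty b)).
Proof. by rewrite stable_powE; exists (ker_part b), [::]; split=> //=. Qed.

(* Britton's lemma; the retraction rho provides canonical coset representatives,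
   namely the elements of its kernel. *)
Lemma hnn_starts_cons e e' b x :
    hnn_starts e' x -> e' = e \/ rho b <> b ->
  hnn_starts e (stable_pow e (base_sym b x)).
Proof.
case: x => -[c s] red_s [k [s' /= [sE cC]]] eb; subst s; rewrite stable_powE.
rewrite /hnn_starts /= /hnn_step /=; case: ifP => [/andP[/eqP bc1 e'e]|_] /=.
  case: eb => [e'E|[]]; first by rewrite e'E eqxx in e'e.
  apply: (mulIg c); rewrite -{1}cC -homM -[RHS]mul_ker_part bc1 mulg1.
  by [].
by exists (ker_part (b * c)), ((e', k) :: s').
Qed.

End SplitHNN.

(** * Comparison with an HNN extension over a doubled base *)

Section DoubledBase.
Local Open Scope group_scope.
Variables (Gam : sgraph) (v : Gam) (S1 S2 : Gam -> bool).
Hypothesis S12 : forall u, ~~ S1 u -> ~~ S2 u -> sg_adj v u.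
Local Notation A := (raag Gam).

Lemma raag_kill (S : Gam -> bool) : exists F : {multiplicative A -> A},
  forall u, F (vgen u) = if S u then 1 else vgen u.
Proof.
apply: raag_lift => u w uw; case: ifP => _; first exact/commute_sym/commute1.
by case: ifP => _; [apply: commute1|apply: raag_gen_commute].
Qed.

Definition kill S : {multiplicative A -> A} := projT1 (cid (raag_kill S)).

Lemma kill_gen S u : kill S (vgen u) = if S u then 1 else vgen u.
Proof. exact: (projT2 (cid (raag_kill S))). Qed.

Lemma killK S g : kill S (kill S g) = kill S g.
Proof.
pose F : {multiplicative A -> A} := kill S \o kill S.
apply: (presented_hom_ext (F := F)) => u.
by rewrite /F /= kill_gen; case: ifP => Su; rewrite ?hom1 // kill_gen Su.
Qed.

Definition diag (g : A) : A * A := (g, g).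

HB.instance Definition _ :=
  isMultiplicative.Build A (A * A)%type diag (fun _ _ => erefl).

Definition kill_pair (p : A * A) : A * A := (kill S1 p.1, kill S2 p.2).

Lemma kill_pairM : {morph kill_pair : p q / p * q}.
Proof. by move=> p q; congr pair; apply: homM. Qed.

HB.instance Definition _ :=
  isMultiplicative.Build (A * A)%type (A * A)%type kill_pair kill_pairM.

Lemma kill_pairK p : kill_pair (kill_pair p) = kill_pair p.
Proof. by rewrite /kill_pair /= !killK. Qed.

Lemma kill_pair_commute g : kill_pair (g, g) = (g, g) -> commute (vgen v) g.
Proof.
have vC h : commute (vgen v) (kill S1 (kill S2 h)).
  elim/presented_ind: h => [|u h IHh|u h IHh];
    first by rewrite !hom1; apply: commute1.
    rewrite !homM; apply: commuteM => //; rewrite kill_gen.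
    case: ifPn => u2; first by rewrite hom1; apply: commute1.
    rewrite kill_gen; case: ifPn => u1; first exact: commute1.
    exact/raag_gen_commute/S12.
  rewrite !homM; apply: commuteM => //; rewrite !homV kill_gen; apply: commuteV.
  case: ifPn => u2; first by rewrite hom1; apply: commute1.
  rewrite kill_gen; case: ifPn => u1; first exact: commute1.
  exact/raag_gen_commute/S12.
by case=> g1 g2; have := vC g; rewrite g2 g1.
Qed.

(** The fixed points of [K0] form the subgroup generated by the vertices other than [v]. *)
Local Notation K0 := (kill (fun u => `[< u = v >])).

Definition vpow (e : bool) : A := if e then vgen v else (vgen v)^-1.

(** Pinches are defined by the condition on [(g, g)] in the doubled base, so that reducedness passes
    directly to the HNN extension over that base. *)
Inductive v_reduced : bool -> A -> Prop :=
| VReducedEnd e g : K0 g = g -> v_reduced e (vpow e * g)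
| VReducedCons e e' g a : K0 g = g -> v_reduced e' a ->
    e' = e \/ kill_pair (g, g) <> (g, g) -> v_reduced e (vpow e * (g * a)).

Definition v_form (a : A) : Prop :=
  K0 a = a \/ exists g e r, [/\ K0 g = g, v_reduced e r & a = g * r].

Lemma v_form_base g a : K0 g = g -> v_form a -> v_form (g * a).
Proof.
move=> g0 [a0|[h [e [r [h0 rr ->]]]]]; first by left; rewrite homM g0 a0.
by right; exists (g * h), e, r; rewrite homM g0 h0 mulgA.
Qed.

Lemma v_form_vpow e a : v_form a -> v_form (vpow e * a).
Proof.
case=> [a0|[g [e' [r [g0 rr ->]]]]].
  right; exists 1, e, (vpow e * a); rewrite hom1 mul1g.
  by split=> //; constructor.
have [ok|nok] := pselect (e' = e \/ kill_pair (g, g) <> (g, g)).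
  right; exists 1, e, (vpow e * (g * r)); rewrite hom1 mul1g; split=> //.
  exact: VReducedCons ok.
(* At a pinch [g] commutes with [v], so the two opposite powers of [v] cancel. *)
have gC : commute g (vgen v).
  apply: commute_sym; apply: kill_pair_commute; apply: contrapT => ng.
  by apply: nok; right.
have e'E : e' = ~~ e by case: e e' nok {rr} => [] [] // [] ; left.
have cancel h : vpow e * (g * (vpow e' * h)) = g * h.
  have gCe : commute g (vpow e') by case: (e') => //; apply: commuteV.
  rewrite [g * (_ * h)]mulgA gCe e'E -!mulgA.
  by case: (e); rewrite /= ?mulKg ?mulVKg.
case: rr cancel => {e'E gC nok} [e2 h h0|e2 e3 h b h0 rb _] ->.
  by left; rewrite homM g0 h0.
by right; exists (g * h), e3, b; rewrite homM g0 h0 mulgA.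
Qed.

Lemma v_formP a : v_form a.
Proof.
have K0gen u : u <> v -> K0 (vgen u) = vgen u.
  by move=> uv; rewrite kill_gen; case: asboolP.
elim/presented_ind: a => [|u g IHg|u g IHg]; first by left; rewrite hom1.
  have [->|/K0gen u0] := pselect (u = v); first exact: (v_form_vpow true).
  exact: v_form_base.
have [->|/K0gen u0] := pselect (u = v); first exact: (v_form_vpow false).
by apply: v_form_base => //; rewrite homV u0.
Qed.

(* A diagonal element fixed by [kill_pair] only involves vertices outside both S1
   and S2, hence commutes with v: the subgroup of the base that commutes with the
   stable letter meets the diagonal exactly where it should. *)
Lemma doubled_base_inj
    (Om : {multiplicative A -> self_bij (hnn_word kill_pair)}) :
    Om (vgen v) = stable kill_pairK ->
    (forall u, u <> v -> Om (vgen u) = base_sym kill_pair (vgen u, vgen u)) ->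
  injective Om.
Proof.
move=> Omv Omu.
have [BS BSE] : exists BS : {multiplicative A -> self_bij (hnn_word kill_pair)},
    forall g, BS g = base_sym kill_pair (g, g).
  by exists (base_sym kill_pair \o diag).
have OmB g : K0 g = g -> Om g = base_sym kill_pair (g, g).
  pose F1 : {multiplicative A -> self_bij (hnn_word kill_pair)} := Om \o K0.
  pose F2 : {multiplicative A -> self_bij (hnn_word kill_pair)} := BS \o K0.
  move=> g0; suff: F1 g = F2 g by rewrite /F1 /F2 /= g0 BSE.
  apply: presented_hom_ext => u; rewrite /F1 /F2 [LHS]/= [RHS]/= kill_gen.
  case: asboolP => [_|/Omu->]; last by rewrite BSE.
  by rewrite (hom1 Om) (hom1 BS).
have Ompow e : Om (vpow e) = stable_pow kill_pairK e.
  by case: e; rewrite /= ?homV Omv.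
(* The clauses of [v_reduced] match those of Britton's lemma, so the image of a reduced word keeps a
   stable letter in its normal form and cannot be trivial. *)
have starts e r : v_reduced e r ->
    hnn_starts e (Om r (hnn_empty kill_pair 1)).
  elim=> {e r} [e g g0|e e' g a g0 _ IHa ok].
    rewrite homM sym_mulE (OmB _ g0) Ompow.
    have -> : base_sym kill_pair (g, g) (hnn_empty kill_pair 1)
            = hnn_empty kill_pair (g, g) by apply: val_inj; rewrite /= mulg1.
    exact: hnn_starts_empty.
  rewrite !homM !sym_mulE (OmB _ g0) Ompow.
  exact: hnn_starts_cons IHa ok.
apply: hom_inj => a Oma; case: (v_formP a) => [a0|[g [e [r [g0 rr aE]]]]].
  move: Oma; rewrite (OmB _ a0) =>
    /(congr1 (fun f : self_bij _ => val (f (hnn_empty kill_pair 1)))).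
  by rewrite /= mulg1 => -[].
move: Oma; rewrite aE homM (OmB _ g0) =>
    /(congr1 (fun f : self_bij _ => val (f (hnn_empty kill_pair 1)))).
have [k [s [sE _]]] := starts _ _ rr.
by rewrite /= sE.
Qed.

End DoubledBase.

(** * The pentagon and complements of paths *)

Definition copath_adj n (i j : 'I_n) : bool := (i.+1 < j) || (j.+1 < i).

Lemma copath_adj_sym n (i j : 'I_n) : copath_adj i j -> copath_adj j i.
Proof. by rewrite /copath_adj orbC. Qed.

Lemma copath_adj_irr n (i : 'I_n) : ~ copath_adj i i.
Proof. by rewrite /copath_adj; lia. Qed.

Definition copath_graph (n : nat) : sgraph :=
  SGraph (@copath_adj_sym n) (@copath_adj_irr n).

Section PentagonInCopath.
Local Open Scope group_scope.
Local Notation C5 := (cycle_graph 5).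
Local Notation A := (raag C5).
Local Notation g5 := (gen (@raag_rel C5)).
Local Notation g9 := (gen (@raag_rel (copath_graph 9))).

Definition pent (k : nat) : 'I_5 := inord k.

(* The complement of the pentagon is the pentagon 0, 2, 4, 1, 3, and the path on
   nine vertices winds almost twice around it, from 2 to 3, with 0 in the middle. *)
Definition winding (k : nat) : 'I_5 :=
  pent (nth 0%N [:: 2; 4; 1; 3; 0; 2; 4; 1; 3]%N k).

Lemma cycle5E i j : i < 5 -> j < 5 ->
  @cycle_adj 5 (pent i) (pent j) =
  (i != j) && ((j == i.+1 %% 5) || (i == j.+1 %% 5))%N.
Proof. by move=> i5 j5; rewrite /cycle_adj -!val_eqE /= !inordK. Qed.

(** The path neighbours of the middle position 4 are position 5, over 2 and in the first factor, and
    position 3, over 3 and in the second. Killing these and 0 leaves in each factor what must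
    commute with the stable letter. *)
Local Notation rho := (@kill_pair C5
  (fun u : 'I_5 => nat_of_ord u \in [:: 0; 2]%N)
  (fun u : 'I_5 => nat_of_ord u \in [:: 0; 3]%N)).

Lemma pentagon_not_killed (u : 'I_5) :
    nat_of_ord u \notin [:: 0; 2]%N -> nat_of_ord u \notin [:: 0; 3]%N ->
  @sg_adj C5 (pent 0) u.
Proof.
rewrite /= /cycle_adj -!val_eqE /= !inordK //.
by case: u => [[|[|[|[|[|]]]]] ?].
Qed.

(** Positions on opposite sides of 4 are adjacent in the complement of the path, so the two halves
    act through commuting factors. *)
Definition winding_act (k : nat) : self_bij (hnn_word rho) :=
  if k < 4 then base_sym rho (1, g5 (winding k))
  else if k == 4 then stable (@kill_pairK _ _ _)
  else base_sym rho (g5 (winding k), 1).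

Lemma winding_act_commute i j :
  i.+1 < j -> j < 9 -> commute (winding_act i) (winding_act j).
Proof.
have bC p q : commute p q -> commute (base_sym rho p) (base_sym rho q).
  by move=> pq; rewrite /commute -!base_symM pq.
have gC k l : k < 5 -> l < 5 ->
    (k != l) && ((l == k.+1 %% 5) || (k == l.+1 %% 5)) ->
    commute (g5 (pent k)) (g5 (pent l)).
  by move=> k5 l5 kl; apply: raag_gen_commute; rewrite /= cycle5E.
have pC p q r s : commute p r -> commute q s ->
    commute ((p, q) : A * A) (r, s).
  by move=> pr qs; congr pair.
have fixC p : rho p = p ->
    commute (stable (@kill_pairK _ _ _)) (base_sym rho p).
  exact: stable_base_commute.
have killE S k : kill S (g5 (pent k)) = if S (pent k) then 1 else g5 (pent k).
  exact: kill_gen.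
do 9?[case: j => [|j] //]; do 7?[case: i => [|i] //];
  rewrite /winding_act /= => _ _;
  first [apply: commute_sym; apply: fixC | apply: fixC | apply: bC];
  rewrite /winding /=.
all: try by apply: pC;
  first [apply: commute1 | apply/commute_sym/commute1 | apply: gC].
all: by rewrite /kill_pair /= killE hom1 /= !inordK.
Qed.

Lemma pentagon_in_copath : embeds A (raag (copath_graph 9)).
Proof.
(* [pos u] is the first position over [u]; for [u] other than 0 the second one comes five steps
   later. *)
pose pos (u : C5) := nth 0%N [:: 4; 2; 0; 3; 1]%N u.
pose y k := g9 (inord k).
have yC i j : i.+1 < j -> j < 9 -> commute (y i) (y j).
  move=> ij j9; apply: raag_gen_commute.
  by rewrite /= /copath_adj !inordK ?ij //; lia.
pose f (u : C5) := if val u == 0 then y 4 else y (pos u) * y (pos u + 5)%N.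
have fC u w : sg_adj u w -> commute (f u) (f w).
  { have yfar i j : i.+1 < j \/ j.+1 < i -> i < 9 -> j < 9 -> commute (y i) (y j).
    by case=> ij i9 j9; [|apply: commute_sym]; apply: yC.
  rewrite /f /pos; case: u => [[|[|[|[|[|//]]]]] ?];
    case: w => [[|[|[|[|[|//]]]]] ?] //= _.
  all: first
    [ by apply: commuteM; apply: yfar; lia
    | by apply: commute_sym; apply: commuteM; apply: yfar; lia
    | by apply: commuteM; apply: commute_sym; apply: commuteM; apply: yfar; lia ]. }
have [Phi PhiE] := raag_lift fC.
have [|Theta ThetaE] :=
    @raag_lift (copath_graph 9) (self_bij (hnn_word rho)) winding_act.
  move=> i j /orP[] ij; [|apply: commute_sym]; exact: winding_act_commute.
have ThetaY k : k < 9 -> Theta (y k) = winding_act k.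
  by move=> k9; rewrite ThetaE inordK.
exists Phi.
pose Om : {multiplicative A -> self_bij (hnn_word rho)} := Theta \o Phi.
(* Under the action, the product of the two positions over [u] becomes a diagonal element of the
   base, as [doubled_base_inj] requires. *)
suff /inj_compr : injective Om by [].
have := @doubled_base_inj C5 (pent 0) _ _ pentagon_not_killed Om; apply.
  by rewrite /Om /= PhiE /f /= inordK //= ThetaY.
move=> u u0; rewrite /Om [LHS]/= PhiE /f ifF; last first.
  by apply/eqP => uE; apply: u0; apply: val_inj; rewrite /= inordK.
have pos4 : pos u < 4.
  by case: u u0 => [[|[|[|[|[|]]]]] ?] //= []; apply: val_inj; rewrite /= inordK.
rewrite homM !ThetaY; try lia.
rewrite /winding_act pos4 !ifF; try lia.
rewrite -base_symM; congr (base_sym _ (_, _)); rewrite /= ?mul1g ?mulg1.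
  by congr (g5 _); apply: val_inj; rewrite /= inordK;
    case: u u0 pos4 => [[|[|[|[|[|]]]]] ?].
by congr (g5 _); apply: val_inj; rewrite /= inordK;
  case: u u0 pos4 => [[|[|[|[|[|]]]]] ?].
Qed.

End PentagonInCopath.

(** * Longer cycles *)

(** An induced subgraph also lies in the double at any [v], entirely on one side. *)
Lemma raag_induced (Gam Gam' : sgraph) (v : Gam) (f : Gam' -> Gam) :
    injective f -> (forall u u', sg_adj u u' <-> sg_adj (f u) (f u')) ->
  embeds (raag Gam') (raag Gam).
Proof.
move=> f_inj fP; apply: (@raag_double Gam Gam' v f (fun=> false)).
  by move=> u u'; split=> [/fP|[/fP]] //; split=> //; left.
by move=> u u' /f_inj.
Qed.

(* Three paths joining ThetaPath 0 to ThetaPath m: the long one runs through the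
   vertices ThetaPath i, the other two have length 2 and 3. *)
Inductive theta_vertex (m : nat) : Type :=
  ThetaPath of 'I_m.+1 | ThetaMid | ThetaLeft | ThetaRight.
Arguments ThetaMid {m}.
Arguments ThetaLeft {m}.
Arguments ThetaRight {m}.

Definition theta_arc m (x y : theta_vertex m) : bool :=
  match x, y with
  | ThetaPath i, ThetaPath j => i.+1 == j
  | ThetaPath i, ThetaMid => (i == 0 :> nat) || (i == m :> nat)
  | ThetaPath i, ThetaLeft => i == 0 :> nat
  | ThetaPath i, ThetaRight => i == m :> nat
  | ThetaLeft, ThetaRight => true
  | _, _ => false
  end.

Definition theta_adj m (x y : theta_vertex m) : bool :=
  theta_arc x y || theta_arc y x.

Lemma theta_adj_sym m (x y : theta_vertex m) : theta_adj x y -> theta_adj y x.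
Proof. by rewrite /theta_adj orbC. Qed.

Lemma theta_adj_irr m (x : theta_vertex m) : ~ theta_adj x x.
Proof. by case: x => [i|||]; rewrite /theta_adj //= orbb; lia. Qed.

Definition theta_graph (m : nat) : sgraph :=
  SGraph (@theta_adj_sym m) (@theta_adj_irr m).

Definition theta_side m (x : theta_vertex m) : bool :=
  match x with ThetaLeft | ThetaRight => true | _ => false end.

Section ThetaStep.
Variable m : nat.
Hypothesis m2 : 1 < m.

(* Doubling at ThetaLeft makes two copies of the path of length 2; the second
   copy becomes part of the new path of length 3, the old ThetaRight the new
   endpoint. *)
Definition theta_fold (x : theta_vertex m.+1) : theta_vertex m :=
  match x with
  | ThetaPath i => if i <= m then ThetaPath (inord i) else ThetaRight
  | ThetaMid => ThetaLeft
  | ThetaLeft => ThetaMid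
  | ThetaRight => ThetaPath ord_max
  end.

Definition theta_star (x : theta_vertex m) : bool :=
  match x with ThetaPath i => i == 0 :> nat | ThetaMid => false | _ => true end.

Lemma theta_starE (x : theta_vertex m) :
  @star (theta_graph m) ThetaLeft x = theta_star x.
Proof.
apply: propext; rewrite /star /= /theta_adj; case: x => [i|||] /=; split=> //.
- by case.
- by right.
- by case.
- by left.
- by right.
Qed.

(** Dropped from the double are the first copy of [ThetaMid] and the second copies of the inner
    vertices of the long path. The old [ThetaRight] lengthens the long path by one, and the old
    [ThetaLeft] becomes the middle of the path of length 2. *)
Lemma theta_step :
  embeds (raag (theta_graph m.+1)) (raag (theta_graph m)).
Proof.
apply: (@raag_double (theta_graph m) (theta_graph m.+1) ThetaLeft theta_fold
         (@theta_side m.+1)).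
  move=> x y; rewrite !theta_starE /sg_adj /= /theta_adj.
  case: x y => [i|||] [j|||] /=.
  all: try have := ltn_ord i.
  all: try have := ltn_ord j.
  all: repeat case: ifPn => ?.
  all: rewrite /= ?inordK; try lia.
move=> x y; rewrite !theta_starE; case: x y => [i|||] [j|||] //=.
all: repeat case: ifPn => ? //.
all: try (have i_ub := ltn_ord i); try (have j_ub := ltn_ord j).
- case=> /(congr1 val); rewrite /= !inordK // => ij _.
  by congr ThetaPath; apply: val_inj.
- by move=> _ _; congr ThetaPath; apply: val_inj => /=; lia.
- by case=> /(congr1 val); rewrite /= inordK // => ->; lia.
- by lia.
Qed.

End ThetaStep.

(** This is the full double of the pentagon at the vertex 1: the star is 0, 1, 2, and the path 0, 4,
    3, 2 appears twice. *)
Lemma theta_pentagon : embeds (raag (theta_graph 3)) (raag (cycle_graph 5)).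
Proof.
pose f (x : theta_vertex 3) : 'I_5 := match x with
  | ThetaPath i => inord (nth 0 [:: 0; 4; 3; 2] i)
  | ThetaMid => inord 1 | ThetaLeft => inord 4 | ThetaRight => inord 3 end.
have starE (x : 'I_5) : @star (cycle_graph 5) (inord 1 : 'I_5) x = (x < 3).
  apply: propext; rewrite /star /= /cycle_adj -!val_eqE /= !inordK //.
  split=> [[->|]|]; first by rewrite inordK.
    by case: x => [[|[|[|[|[|//]]]]] ?].
  case: (x =P inord 1) => [|n1 x3]; [by left|right].
  by case: x n1 x3 => [[|[|[|//]]] ?] // []; apply: val_inj; rewrite /= inordK.
apply: (@raag_double (cycle_graph 5) (theta_graph 3) (inord 1 : 'I_5) f
         (@theta_side 3)).
  move=> x y; rewrite !starE /sg_adj /= /theta_adj /cycle_adj -!val_eqE.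
  case: x y => [[[|[|[|[|//]]]] ?]|||] [[[|[|[|[|//]]]] ?]|||];
    rewrite /= !inordK //=; lia.
move=> x y /(congr1 val); rewrite starE.
case: x y => [[[|[|[|[|//]]]] ?]|||] [[[|[|[|[|//]]]] ?]|||];
  rewrite /= !inordK //=; try (move=> _ _; congr ThetaPath; exact: val_inj).
all: lia.
Qed.

Lemma theta_in_pentagon m : 2 < m ->
  embeds (raag (theta_graph m)) (raag (cycle_graph 5)).
Proof.
elim: m => [//|m IHm] m2.
have [->|m3] := eqVneq m 2; first exact: theta_pentagon.
by apply: (embeds_trans (theta_step _)); [lia | apply: IHm; lia].
Qed.

(** The long path closes up through [ThetaMid], which is adjacent only to its two ends. *)
Lemma cycle_in_theta m : 2 < m ->
  embeds (raag (cycle_graph m.+2)) (raag (theta_graph m)).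
Proof.
move=> m2.
pose f (i : 'I_m.+2) : theta_vertex m :=
  if i <= m then ThetaPath (inord i) else ThetaMid.
have ordSE (i : 'I_m.+2) : val (ordS i) = if i <= m then i.+1 else 0.
  rewrite /=; case: ifPn => im; first by rewrite modn_small.
  by have -> : i = m.+1 :> nat; [have := ltn_ord i; lia | rewrite modnn].
apply: (@raag_induced (theta_graph m) (cycle_graph m.+2) ThetaMid f).
  move=> i j; rewrite /f; case: ifPn => im; case: ifPn => jm //.
    by case=> /(congr1 val); rewrite /= !inordK // => ij; apply: val_inj.
  by move=> _; apply: val_inj => /=; have := ltn_ord i; have := ltn_ord j; lia.
move=> i j; rewrite /sg_adj /= /cycle_adj /theta_adj -!val_eqE !ordSE /f.
have := ltn_ord i; have := ltn_ord j.
by case: ifPn => im; case: ifPn => jm; rewrite /= ?inordK //; lia.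
Qed.

(** * Complements of paths and diagram groups *)

(** [Base i] is the letter x_i; [LoopA i] and [LoopB i] are the other two corners of the triangle at
    x_i x_(i+1). *)
Inductive letter : Type := Base of nat | LoopA of nat | LoopB of nat.

Inductive letter_rel : seq letter * seq letter -> Prop :=
| RelBaseA i : letter_rel ([:: Base i; Base i.+1], [:: LoopA i])
| RelAB i : letter_rel ([:: LoopA i], [:: LoopB i])
| RelBBase i : letter_rel ([:: LoopB i], [:: Base i; Base i.+1]).

Lemma letter_rel_nonempty u v : letter_rel (u, v) -> u <> [::] /\ v <> [::].
Proof. by move=> uv; inversion uv. Qed.

Lemma letter_rel_asym u v : letter_rel (u, v) -> ~ letter_rel (v, u).
Proof. by move=> uv vu; inversion uv; subst; inversion vu. Qed.

Definition triangles : semigroupPresentation :=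
  @SemigroupPresentation letter letter_rel letter_rel_nonempty letter_rel_asym.

Definition base_word (m n : nat) : seq letter := [seq Base i | i <- iota m n].

(** * Edge paths in Squier complexes *)

Section SquierPaths.
Variable P : semigroupPresentation.
Local Notation word := (seq (sp_alphabet P)).
Local Notation S := (squier P).

Definition lift_path (a : word) (rs : seq (rewriting P)) (b : word) :
    seq (sc_edge S) :=
  [seq SquierEdge a r b | r <- rs].

Fixpoint rw_path (u : word) (rs : seq (rewriting P)) (v : word) : Prop :=
  if rs is r :: rs' then rw_lhs r = u /\ rw_path (rw_rhs r) rs' v else u = v.

Lemma lift_pathP a u rs v b : rw_path u rs v ->
  @is_edge_path S (a ++ u ++ b) (lift_path a rs b) (a ++ v ++ b).
Proof. by elim: rs u => [|r rs IHrs] u /= => [->//|[<- /IHrs]]. Qed.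

Lemma path_step_edge_path (X : squareComplex) (x y : X) p q :
  path_step p q -> is_edge_path x p y -> is_edge_path x q y.
Proof.
case=> [s t e|s t e1 e2 f1 f2 sq]; elim: s x => [|g s IHs] x /=; try
  by case=> -> /IHs.
  by case=> <- []; rewrite sc_src_inv sc_tgt_inv => _.
by have [<- _ -> <-] := sc_squareP sq; move=> [? []].
Qed.

(** Arbitrary edge sequences are allowed, so that segments of a loop can be rewritten. Steps go one
    way only, because inserting a backtrack need not preserve edge paths. *)
Definition path_steps (X : squareComplex) :=
  clos_refl_trans (seq (sc_edge X)) (@path_step X).

Lemma path_steps_edge_path (X : squareComplex) (x y : X) p q :
  path_steps p q -> is_edge_path x p y -> is_edge_path x q y.
Proof.
elim=> {p q} [p q|//|p q r _ pq _ qr /pq/qr //]; exact: path_step_edge_path.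
Qed.

Lemma path_steps_homotopic (X : squareComplex) (x : X) p q
    (hp : is_edge_path x p x) (hq : is_edge_path x q x) :
  path_steps p q -> homotopic (Loop hp) (Loop hq).
Proof.
move=> pq; elim: pq hp hq => {p q} [p q pq|p|p q r pq IHpq _ IHqr] hp hq.
- exact: rst_step.
- exact: homotopic_eq.
- have hr := path_steps_edge_path pq hp.
  exact: rst_trans (IHpq hp hr) (IHqr hr hq).
Qed.

Lemma path_steps_cat (X : squareComplex) s t (p q : seq (sc_edge X)) :
  path_steps p q -> path_steps (s ++ p ++ t) (s ++ q ++ t).
Proof.
elim=> {p q} [p q pq|p|p q r _ pq _ qr]; last exact: rt_trans pq qr;
  last exact: rt_refl.
apply: rt_step; case: pq => [s' t' e|s' t' e1 e2 f1 f2 sq];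
  by rewrite -!catA !(catA s); constructor.
Qed.

(** Rewritings at two disjoint subwords span a grid of squares; [swap1] crosses one row of it. *)
Lemma lift_path_swap a u rs u' b w ss w' c :
  rw_path u rs u' -> rw_path w ss w' ->
  @path_steps S (lift_path a rs (b ++ w ++ c) ++ lift_path (a ++ u' ++ b) ss c)
    (lift_path (a ++ u ++ b) ss c ++ lift_path a rs (b ++ w' ++ c)).
Proof.
have swap1 r : forall ss w, rw_path w ss w' ->
   @path_steps S
    (SquierEdge a r (b ++ w ++ c) :: lift_path (a ++ rw_rhs r ++ b) ss c)
    (rcons (lift_path (a ++ rw_lhs r ++ b) ss c)
       (SquierEdge a r (b ++ w' ++ c))).
  elim=> {w ss} [|s ss IHss] w /= => [->|[<- /IHss ss_w']]; first exact: rt_refl.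
  apply: (rt_trans _ _ _ (SquierEdge (a ++ rw_lhs r ++ b) s c ::
    SquierEdge a r (b ++ rw_rhs s ++ c) ::
    lift_path (a ++ rw_rhs r ++ b) ss c)).
    apply: rt_step; apply: (@PSquare S [::]); exact: SquierSquare.
  have := @path_steps_cat S
    [:: SquierEdge (a ++ rw_lhs r ++ b) s c] [::] _ _ ss_w'.
  by rewrite !cats0.
move=> urs wss; elim: rs u urs => [|r rs IHrs] u /= => [->|[<- /IHrs rs_u']].
  by rewrite cats0; apply: rt_refl.
apply: (rt_trans _ _ _ (SquierEdge a r (b ++ w ++ c) ::
    lift_path (a ++ rw_rhs r ++ b) ss c ++ lift_path a rs (b ++ w' ++ c))).
  by have := @path_steps_cat S [:: SquierEdge a r (b ++ w ++ c)] [::] _ _ rs_u';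
    rewrite !cats0.
have := @path_steps_cat S [::] (lift_path a rs (b ++ w' ++ c)) _ _
  (swap1 r _ _ wss).
by rewrite cat_rcons.
Qed.

End SquierPaths.

(** * Triangles of rewritings and edge labels *)

Section CopathDiagrams.
Variable N : nat.
Local Notation S := (squier triangles).
Local Notation Rw r := (@Rewriting triangles _ _ (or_introl r)).

Lemma base_word_cat m n p :
  base_word m (n + p) = base_word m n ++ base_word (m + n) p.
Proof. by rewrite /base_word iotaD map_cat. Qed.

Lemma base_word_cat2 m i p : m <= i ->
  base_word m (i - m) ++ base_word i 2 ++ base_word i.+2 p =
  base_word m (i - m + p.+2).
Proof.
move=> mi; rewrite -[i.+2]addn2 -base_word_cat -{2}(subnKC mi) -base_word_cat.
by rewrite add2n.
Qed.

(* A triangle, since the convention on relations excludes the loop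
   [Base i; Base i.+1] = [Base i; Base i.+1] and the bigon. *)
Definition triangle (i : nat) : seq (rewriting triangles) :=
  [:: Rw (RelBaseA i); Rw (RelAB i);
      Rw (RelBBase i)].

Lemma triangleP i :
  @rw_path triangles (base_word i 2) (triangle i) (base_word i 2).
Proof. by []. Qed.

Definition triangle_path (i : nat) : seq (sc_edge S) :=
  @lift_path triangles (base_word 0 i) (triangle i) (base_word i.+2 (N - i.+1)).

Definition top_word : S := base_word 0 N.+1.

Lemma triangle_pathP (i : 'I_N) :
  @is_edge_path S top_word (triangle_path i) top_word.
Proof.
have -> : top_word =
    base_word 0 i ++ base_word i 2 ++ base_word i.+2 (N - i.+1).
  rewrite -{1}(subn0 i) base_word_cat2 //; congr base_word.
  by have := ltn_ord i; lia.
exact/lift_pathP/triangleP.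
Qed.

Lemma triangle_path_swap i j : i.+1 < j -> j < N ->
  @path_steps S (triangle_path i ++ triangle_path j)
             (triangle_path j ++ triangle_path i).
Proof.
move=> ij jN; rewrite /triangle_path.
have -> : base_word i.+2 (N - i.+1) =
    base_word i.+2 (j - i.+2) ++ base_word j 2 ++ base_word j.+2 (N - j.+1).
  by rewrite base_word_cat2 //; congr base_word; lia.
have -> : base_word 0 j =
    base_word 0 i ++ base_word i 2 ++ base_word i.+2 (j - i.+2).
  by rewrite -{1}(subn0 i) base_word_cat2 //; congr base_word; lia.
exact/lift_path_swap/triangleP/triangleP.
Qed.

(** Both sides of every relation have the same expansion, so it is constant on each component of the
    Squier complex. *)
Definition expand (u : seq letter) : seq nat :=
  flatten [seq match l with
               | Base i => [:: i]
               | LoopA i | LoopB i => [:: i; i.+1]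
               end | l <- u].

Lemma expand_cat u v : expand (u ++ v) = expand u ++ expand v.
Proof. by rewrite /expand map_cat flatten_cat. Qed.

Lemma expand_base_word m n : expand (base_word m n) = iota m n.
Proof.
by elim: n m => [|n IHn] m //=; rewrite -[RHS]/(m :: iota m.+1 n) -IHn.
Qed.

Lemma rw_expand (r : rewriting triangles) :
  exists i, expand (rw_lhs r) = [:: i; i.+1] /\ expand (rw_rhs r) = [:: i; i.+1].
Proof. by case: r => u v [] /= uv; inversion uv; eexists; split. Qed.

Section Label.
Local Open Scope group_scope.
Variables (H : groupType) (h : nat -> H).
Hypothesis hC : forall i j, i.+1 < j -> j < N -> commute (h i) (h j).

(** Only the last side of a triangle carries [h i], so one turn around the triangle contributes
    exactly [h i]. *)
Definition rw_label (u v : seq letter) : H :=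
  match u, v with
  | [:: LoopB i], [:: Base _; Base _] => h i
  | [:: Base _; Base _], [:: LoopB i] => (h i)^-1
  | _, _ => 1
  end.

Lemma rw_label_inv (r : rewriting triangles) :
  rw_label (rw_rhs r) (rw_lhs r) = (rw_label (rw_lhs r) (rw_rhs r))^-1.
Proof. case: r => u v [] /= uv; inversion uv => /=.
all: by rewrite ?invgK ?invg1. Qed.

Lemma rw_label_expand (r : rewriting triangles) i :
  expand (rw_lhs r) = [:: i; i.+1] ->
  [\/ rw_label (rw_lhs r) (rw_rhs r) = 1, rw_label (rw_lhs r) (rw_rhs r) = h i |
      rw_label (rw_lhs r) (rw_rhs r) = (h i)^-1].
Proof.
by case: r => u v [] /= uv; inversion uv; case=> <- /=;
  first [constructor 1; reflexivity | constructor 2; reflexivity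
        |constructor 3; reflexivity].
Qed.

(** Away from the expansion 0, 1, ..., N of [top_word], disjoint rewritings need not have commuting
    labels; hence the label 1 there. *)
Definition edge_label (e : sc_edge S) : H :=
  if expand (sc_src e) == iota 0 N.+1
  then rw_label (rw_lhs (se_rw e)) (rw_rhs (se_rw e)) else 1.

Definition path_label (p : seq (sc_edge S)) : H := \prod_(e <- p) edge_label e.

Lemma path_label_cat p q : path_label (p ++ q) = path_label p * path_label q.
Proof. by rewrite /path_label big_cat. Qed.

(** The expansion is increasing, so successive disjoint pairs i, i+1 and j, j+1 in it satisfy i+1 <
    j. *)
Lemma rw_label_commute (r1 r2 : rewriting triangles) (a b c : seq letter) :
    expand (a ++ rw_lhs r1 ++ b ++ rw_lhs r2 ++ c) = iota 0 N.+1 ->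
  commute (rw_label (rw_lhs r1) (rw_rhs r1)) (rw_label (rw_lhs r2) (rw_rhs r2)).
Proof.
have [i [r1i _]] := rw_expand r1; have [j [r2j _]] := rw_expand r2.
rewrite !expand_cat r1i r2j => abc.
have ij : i.+1 < j.
  have sub_ij : subseq ([::] ++ [:: i.+1] ++ [::] ++ [:: j] ++ [::])
      (expand a ++ [:: i; i.+1] ++ expand b ++ [:: j; j.+1] ++ expand c).
    by do !apply: cat_subseq; rewrite ?sub0seq //=; case: eqP; rewrite ?eqxx.
  have := subseq_sorted ltn_trans sub_ij; rewrite abc iota_ltn_sorted.
  by case/(_ isT)/andP.
have jN : j < N.
  have: j.+1 \in iota 0 N.+1 by rewrite -abc !mem_cat !inE eqxx !orbT.
  by rewrite mem_iota.
case: (rw_label_expand r1i) => ->; case: (rw_label_expand r2j) => ->.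
all: do ?[apply: commuteV]; try apply: commute1; apply: commute_sym.
all: do ?[apply: commuteV]; try apply: commute1; exact/commute_sym/hC.
Qed.

Lemma path_label_step p q : path_step p q -> path_label p = path_label q.
Proof.
case=> [s t e|s t e1 e2 f1 f2 sq]; rewrite !path_label_cat; congr (_ * _).
  rewrite /path_label !big_cons mulgA -[RHS]mul1g; congr (_ * _).
  rewrite /edge_label sc_src_inv.
  have -> : expand (sc_tgt e) = expand (sc_src e).
    by case: e => a r b; rewrite /= /squier_tgt /squier_src !expand_cat;
      have [i [-> ->]] := rw_expand r.
  by case: ifP => _; rewrite ?mulg1 //= rw_label_inv mulgV.
rewrite /path_label !big_cons !mulgA; congr (_ * _).
case: sq => a r1 b r2 c; rewrite /edge_label /= /squier_src /=.
have [i [r1i r1i']] := rw_expand r1; have [j [r2j r2j']] := rw_expand r2.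
rewrite -!catA !expand_cat r1i r1i' r2j r2j'.
case: eqP => [E|_]; last by rewrite mulg1.
apply: (rw_label_commute (a := a) (b := b) (c := c)).
by rewrite !expand_cat r1i r2j.
Qed.

Lemma label_triangle (i : 'I_N) : path_label (triangle_path i) = h i.
Proof.
have E : expand (base_word 0 i) ++ [:: val i; i.+1] ++
    expand (base_word i.+2 (N - i.+1)) = iota 0 N.+1.
  rewrite -[[:: _; _]]/(iota i 2) !expand_base_word -[i.+2]addn2 -!iotaD.
  by congr iota; have := ltn_ord i; lia.
rewrite /path_label !big_cons big_nil /edge_label /= /squier_src.
rewrite [se_left _]/= [se_right _]/= [rw_lhs _]/= !expand_cat -/(expand _).
rewrite [expand [:: Base _; _]]/= [expand [:: LoopA _]]/=.
rewrite [expand [:: LoopB _]]/=.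
by rewrite E eqxx /= !mulg1 !mul1g.
Qed.

End Label.

Lemma copath_diagrams :
  embeds (raag (copath_graph N)) (@diagram_group triangles top_word).
Proof.
pose D := @diagram_group triangles top_word.
pose L (i : 'I_N) : pi1_preGroup top_word := Loop (triangle_pathP i).
have LC (i j : 'I_N) : i.+1 < j -> commute (quot_pi (L i)) (quot_pi (L j)).
  move=> ij; rewrite /commute -!quot_piM; apply/quot_piP.
  exact/path_steps_homotopic/triangle_path_swap.
have [|Phi PhiE] := @raag_lift (copath_graph N) D (fun i => quot_pi (L i)).
  by move=> i j /orP[] ij; [|apply: commute_sym]; apply: LC.
(* Labels in the Artin group itself make the label map a left inverse of [Phi]; indices from [N] on
   get the default 1. *)
pose h (k : nat) : raag (copath_graph N) :=
  if insub k is Some i then gen (@raag_rel (copath_graph N)) i else 1%g.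
have hC i j : i.+1 < j -> j < N -> commute (h i) (h j).
  move=> ij jN; rewrite /h; have iN : i < N by lia.
  by rewrite !insubT; apply: raag_gen_commute; rewrite /= /copath_adj /= ij.
pose f (p : pi1_preGroup top_word) := path_label h (loop_path p).
have [||Psi PsiE] := @quot_lift (pi1_preGroup top_word) _ f.
- move=> p q; elim=> {p q} [p q|//|p q _ //|p q r _ -> _ //].
  exact: path_label_step.
- by move=> p q; apply: path_label_cat.
have PsiPhi : forall g, Psi (Phi g) = g.
  pose F : {multiplicative raag (copath_graph N) -> raag (copath_graph N)} :=
    Psi \o Phi.
  apply: (presented_hom_ext (F := F) (F' := idfun)) => i.
  by rewrite /F /= PhiE PsiE /f label_triangle /h valK.
by exists Phi; apply: can_inj PsiPhi.
Qed.

End CopathDiagrams.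

(** * All cycles in one diagram group *)

Theorem corollary1p12 (n : nat) (hn : 1 <= n) :
  exists G : groupType, is_diagram_group G /\ embeds (raag (cycle_graph n)) G.
Proof.
exists (@diagram_group triangles (top_word 9)); split.
  exists triangles, (top_word 9); split=> //.
  by exists idfun; exists idfun.
apply: embeds_trans (copath_diagrams 9).
case: (ltnP n 5) => n5; last first.
  apply: embeds_trans pentagon_in_copath.
  have -> : n = (n - 2).+2 by lia.
  by apply: embeds_trans (cycle_in_theta _) (theta_in_pentagon _); lia.
(* Vertices of an induced cycle in the complement of the path: pairwise non-consecutive for n < 4,
   while for n = 4 the diagonals are the consecutive pairs 0, 1 and 3, 4. *)
pose g k := nth 0 (nth [::]
  [:: [::]; [:: 0]; [:: 0; 2]; [:: 0; 2; 4]; [:: 0; 3; 1; 4]] k).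
have gP i j : i < n -> j < n -> [/\ g n i < 9, (g n i == g n j) = (i == j) &
    ((g n i).+1 < g n j) || ((g n j).+1 < g n i) =
    (i != j) && ((j == i.+1 %% n) || (i == j.+1 %% n))].
  move: n5 {hn}; rewrite {}/g.
  case: n => [|[|[|[|[|//]]]]] _; case: i => [|[|[|[|//]]]] //;
    by case: j => [|[|[|[|//]]]].
have g9 (i : 'I_n) : g n i < 9 by have [] := gP i i (ltn_ord i) (ltn_ord i).
apply: (@raag_induced (copath_graph 9) (cycle_graph n) (inord 0 : 'I_9)
  (fun i => Ordinal (g9 i))).
  move=> i j /(congr1 val)/eqP /=.
  have [_ -> _] := gP i j (ltn_ord i) (ltn_ord j).
  by move/eqP/val_inj.
move=> i j; rewrite /sg_adj /= /cycle_adj /copath_adj -!val_eqE /=.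
by have [_ _ ->] := gP i j (ltn_ord i) (ltn_ord j).
Qed.
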